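(* Let $\mathcal{P}$ be a finite poset and $n\ge0$. The following assertions are equivalent for any $\mathbf{x},\mathbf{y}\in\mathcal{P}^n$: (i) $\bar{\mathbf{x}}\le\bar{\mathbf{y}}$, i.e. there exists $\sigma\in\mathfrak{S}_n$ such that $\mathbf{x}\le\mathbf{y}^\sigma$ componentwise; (ii) $\sum_{p\in U}|\mathbf{x}|_p\le\sum_{p\in U}|\mathbf{y}|_p$ for all upper sets $U$ of $\mathcal{P}$; (iii) there exists a nonnegative flow on the Hasse diagram of $\mathcal{P}$ with excess function $p\mapsto|\mathbf{x}|_p-|\mathbf{y}|_p$.
   Context: $\mathcal{P}^n$ is the set of $n$-tuples of elements of $\mathcal{P}$, ordered componentwise. For $\mathbf{x}=(x_1,\dots,x_n)\in\mathcal{P}^n$ and $\sigma\in\mathfrak{S}_n$, $\mathbf{x}^\sigma=(x_{\sigma(1)},\dots,x_{\sigma(n)})$. $\mathcal{P}^n/\mathfrak{S}_n$ is the set of $n$-tuples up to permutation of coordinates, $\bar{\mathbf{x}}$ is the class of $\mathbf{x}$, and $\bar{\mathbf{x}}\le\bar{\mathbf{y}}$ means that there are representatives $\mathbf{x}'\in\bar{\mathbf{x}}$ and $\mathbf{y}'\in\bar{\mathbf{y}}$ with $\mathbf{x}'\le\mathbf{y}'$ componentwise. For $p\in\mathcal{P}$, $|\mathbf{x}|_p$ is the number of occurrences of $p$ in $\mathbf{x}$. An upper set of $\mathcal{P}$ is a subset closed under taking larger elements. The Hasse diagram of $\mathcal{P}$ is the directed graph with an edge $p\to q$ for each cover relation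 $p\lessdot q$. A nonnegative flow is a function $f$ from its edges to the nonnegative reals; its excess at $p$ is (total flow on edges leaving $p$) minus (total flow on edges entering $p$). *)

(* Defs.v *)
From HB Require Import structures.
From mathcomp Require Import all_boot all_order all_algebra all_fingroup.
From mathcomp Require Import reals.

Set Implicit Arguments.
Unset Strict Implicit.
Unset Printing Implicit Defensive.

Import Order.TTheory GRing.Theory Num.Theory.

Local Open Scope order_scope.

(* [n.-tupleprod P] is the library's type of n-tuples carrying the
   componentwise order (see [Order.TupleProdOrder.leEtprod]). *)

Definition perm_tuple (d : Order.disp_t) (P : finPOrderType d) (n : nat)
    (x : n.-tupleprod P) (s : 'S_n) : n.-tupleprod P :=
  [tuple tnth x (s i) | i < n].

(* The elements of P^n / S_n are represented by the orbits of 'S_n, as sets of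
   tuples. *)
Definition sym_class (d : Order.disp_t) (P : finPOrderType d) (n : nat)
    (x : n.-tupleprod P) : {set n.-tupleprod P} :=
  [set perm_tuple x s | s : 'S_n].

Definition sym_class_le (d : Order.disp_t) (P : finPOrderType d) (n : nat)
    (X Y : {set n.-tupleprod P}) : Prop :=
  exists x' y' : n.-tupleprod P, [/\ x' \in X, y' \in Y & x' <= y'].

Definition upper_set (d : Order.disp_t) (P : finPOrderType d)
    (U : {set P}) : Prop :=
  forall p q : P, p \in U -> p <= q -> q \in U.

Definition covers (d : Order.disp_t) (P : finPOrderType d) : rel P :=
  fun p q => (p < q) && ~~ [exists z : P, (p < z) && (z < q)].

Definition hasse_edge (d : Order.disp_t) (P : finPOrderType d) : finType :=
  {e : P * P | covers e.1 e.2}.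

Definition edge_source (d : Order.disp_t) (P : finPOrderType d)
  (e : hasse_edge P) : P := (val e).1.

Definition edge_target (d : Order.disp_t) (P : finPOrderType d)
  (e : hasse_edge P) : P := (val e).2.

Local Open Scope ring_scope.

Definition nonneg_flow (R : realType) (d : Order.disp_t)
    (P : finPOrderType d) (f : hasse_edge P -> R) : Prop :=
  forall e : hasse_edge P, 0 <= f e.

Definition excess (R : realType) (d : Order.disp_t) (P : finPOrderType d)
    (f : hasse_edge P -> R) (p : P) : R :=
  \sum_(e : hasse_edge P | edge_source e == p) f e
  - \sum_(e : hasse_edge P | edge_target e == p) f e.

(* Main.v *)
Require Import Defs.
From mathcomp Require Import all_boot all_order all_algebra all_fingroup.
From mathcomp Require Import reals.

Set Implicit Arguments.
Unset Strict Implicit.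
Unset Printing Implicit Defensive.

(** (i) => (ii) is counting, and (ii) => (i) is Hall's marriage theorem for the
    relation [x_i <= y_j] between indices: apply (ii) to the upper closure of
    the values of [x] on a set of indices. For (i) => (iii), add up unit flows
    along saturated chains from each [x_i] to the matching entry of [y]. For
    (iii) => (ii), an edge leaving a point of an upper set [U] stays in [U], so
    the total excess over [U] is at most [0]. *)

Import Order.TTheory GRing.Theory Num.Theory.

(** * Hall's marriage theorem for a finite relation *)

Section Hall.

Variables (S T : finType) (r : S -> T -> bool).

Definition neighbours (A : {set S}) : {set T} :=
  [set t | [exists s in A, r s t]].

Lemma neighboursP (A : {set S}) (t : T) :
  reflect (exists2 s, s \in A & r s t) (t \in neighbours A).
Proof. by rewrite inE; apply: exists_inP. Qed.

Lemma neighboursU (A B : {set S}) :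
  neighbours (A :|: B) = neighbours A :|: neighbours B.
Proof.
apply/setP => t; rewrite in_setU; apply/neighboursP/orP.
- move=> [s]; rewrite inE => /orP[sA|sB] rst; [left|right];
  by apply/neighboursP; exists s.
- by case=> /neighboursP[s sA rst]; exists s => //; rewrite inE sA ?orbT.
Qed.

Lemma neighboursS (A B : {set S}) :
  A \subset B -> neighbours A \subset neighbours B.
Proof.
move=> sAB; apply/subsetP => t /neighboursP[s sA rst].
by apply/neighboursP; exists s => //; apply: (subsetP sAB).
Qed.

(** [f] is total but only its values on [A] matter, so partial matchings glue by a case
    distinction. *)
Definition matching (A : {set S}) (B : {set T}) (f : S -> T) : Prop :=
  {in A &, injective f} /\ {in A, forall s, (f s \in B) && r s (f s)}.

Lemma matchingU (A1 A2 : {set S}) (B1 B2 : {set T}) (f1 f2 : S -> T) :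
  [disjoint B1 & B2] -> matching A1 B1 f1 -> matching A2 B2 f2 ->
  matching (A1 :|: A2) (B1 :|: B2) (fun s => if s \in A1 then f1 s else f2 s).
Proof.
move=> dB [inj1 m1] [inj2 m2]; split; last first.
  move=> s; rewrite !inE; case: ifP => [sA1 _|_ /= sA2].
  - by case/andP: (m1 s sA1) => -> ->.
  - by case/andP: (m2 s sA2) => -> ->; rewrite orbT.
have diff s t : s \in A1 -> t \in A2 -> f1 s <> f2 t.
  move=> sA1 tA2 eq; case/andP: (m1 s sA1) => sB _; case/andP: (m2 t tA2) => tB _.
  by move: (disjointFr dB sB); rewrite eq tB.
move=> s t; rewrite !inE => sA tA.
case: ifP sA => [sA1 _|_ sA2]; case: ifP tA => [tA1 _|_ tA2].
- exact: inj1.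
- by move/(diff s t sA1 tA2).
- by move/esym/(diff t s tA1 sA2).
- exact: inj2.
Qed.

(** Strong induction on [#|A|], with a case split on the existence of a tight set. Restricting the
    targets to [B] lets the induction hypothesis apply to what is left after a partial matching. The
    element of [T] is the default value when [A] is empty. *)
Lemma hall_in (A : {set S}) (B : {set T}) :
  T -> (forall X : {set S}, X \subset A -> #|X| <= #|neighbours X :&: B|) ->
  exists f, matching A B f.
Proof.
move=> t0; have [k] := ubnP #|A|; elim: k => // k IHk in A B *.
rewrite ltnS => leAk hallAB.
have [->|[a aA]] := set_0Vmem A.
  by exists (fun=> t0); split=> s; rewrite inE.
(* If a nonempty proper subset [X] is tight, [X] is matched inside its neighbours and [A :\: X]
   outside them. *)
have [/existsP[X /and3P[X0 XA tight]]|slack] := boolP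
    [exists X : {set S}, [&& X != set0, X \proper A & #|neighbours X :&: B| <= #|X|]].
  have sXA := proper_sub XA.
  have [f1 m1] : exists f, matching X (B :&: neighbours X) f.
    apply: IHk => [|Y sYX]; first exact: leq_trans (proper_card XA) leAk.
    rewrite [B :&: _]setIC setIA (setIidPl (neighboursS sYX)).
    exact: hallAB (subset_trans sYX sXA).
  have [f2 m2] : exists f, matching (A :\: X) (B :\: neighbours X) f.
    apply: IHk => [|Y sYAX].
      apply: leq_trans leAk; rewrite -(cardsID X A) (setIidPr sXA).
      by rewrite -[X in X < _]add0n ltn_add2r card_gt0.
    have /andP[sYA dYX] : (Y \subset A) && [disjoint Y & X] by rewrite -subsetD.
    (* Hall's condition for [Y]: the condition for [X :|: Y], minus the neighbours of [X] in [B], of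
       which there are at most [#|X|]. *)
    have /hallAB : X :|: Y \subset A by rewrite subUset sXA.
    rewrite cardsU (_ : X :&: Y = set0) ?cards0 ?subn0; last first.
      by apply/eqP; rewrite setI_eq0 disjoint_sym.
    rewrite neighboursU -(cardsID (neighbours X) (_ :&: B)) => le.
    rewrite -(leq_add2l #|X|); apply: (leq_trans le); apply: leq_add.
      apply: leq_trans tight; apply: subset_leq_card.
      by apply/subsetP => t; rewrite !inE => /andP[/andP[_ ->] ->].
    apply: subset_leq_card; apply/subsetP => t; rewrite !in_setI !in_setD in_setI in_setU.
    by case: (t \in neighbours X).
  have dB : [disjoint B :&: neighbours X & B :\: neighbours X].
    by rewrite -setI_eq0 setDE setIACA setICr setI0.
  have := matchingU dB m1 m2; rewrite setID -{1}(setIidPr sXA) setID => m.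
  by eexists; apply: m.
(* Without a tight set, [a] may take any neighbour [b]: removing [b] costs each remaining set at
   most one neighbour, which the strict inequality absorbs. *)
have [b] : exists b, b \in neighbours [set a] :&: B.
  by apply/card_gt0P; rewrite -(cards1 a) hallAB ?sub1set.
rewrite in_setI => /andP[/neighboursP[_ /set1P-> rab] bB].
have [f mf] : exists f, matching (A :\ a) (B :\ b) f.
  apply: IHk => [|Y sYA]; first by move: leAk; rewrite (cardsD1 a) aA.
  have [->|Y0] := eqVneq Y set0; first by rewrite cards0.
  have pYA : Y \proper A := sub_proper_trans sYA (properD1 aA).
  move: slack; rewrite negb_exists => /forallP/(_ Y).
  rewrite Y0 pYA /= -ltnNge setIDA (cardsD1 b (_ :&: B)) => lt.
  by rewrite -ltnS (leq_trans lt) // -add1n leq_add2r leq_b1.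
have m1 : matching [set a] [set b] (fun=> b).
  by split=> [s t /set1P-> /set1P->|s /set1P->] //; rewrite set11.
have dB : [disjoint [set b] & B :\ b] by rewrite disjoints1 !inE eqxx.
have := matchingU dB m1 mf; rewrite !setD1K // => m.
by eexists; apply: m.
Qed.

Lemma hall :
  (forall A : {set S}, #|A| <= #|neighbours A|) ->
  exists2 f : S -> T, injective f & forall s, r s (f s).
Proof.
(* [T] may be empty only if [S] is; otherwise a neighbour of [s0] is the default value. *)
move=> hallS; have [S0|[s0 _]] := set_0Vmem [set: S].
  have noS (s : S) : False by have := in_setT s; rewrite S0 inE.
  by exists (fun s => match noS s with end) => s; case: (noS s).
have [t0 _] : exists t0, t0 \in neighbours [set s0].
  by apply/card_gt0P; rewrite -(cards1 s0).
have [|f [injf mf]] := @hall_in setT setT t0; first by move=> X _; rewrite setIT.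
exists f => [s t|s]; first by apply: injf; rewrite inE.
by case/andP: (mf s (in_setT s)).
Qed.

End Hall.

(** * Tuples up to permutation and domination on upper sets *)

Section SymmetricPower.

Variables (d : Order.disp_t) (P : finPOrderType d) (n : nat).
Implicit Types (x y : n.-tupleprod P) (U : {set P}).

Lemma le_perm_tupleP x y (s : 'S_n) :
  reflect (forall i, (tnth x i <= tnth y (s i))%O) (x <= perm_tuple y s)%O.
Proof.
rewrite Order.TupleProdOrder.leEtprod.
by apply: (iffP forallP) => le i; have := le i; rewrite tnth_mktuple.
Qed.

Lemma sym_class_leP x y :
  sym_class_le (sym_class x) (sym_class y) <->
  exists s : 'S_n, (x <= perm_tuple y s)%O.
Proof.
split=> [[_ [_ [/imsetP[s _ ->] /imsetP[t _ ->]]]]|[s le]].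
  (* Products of permutations act from left to right: [s^-1 * t] sends [i] to [t (s^-1 i)]. *)
  move=> /le_perm_tupleP le; exists (s^-1 * t)%g; apply/le_perm_tupleP => i.
  by have := le ((s^-1)%g i); rewrite tnth_mktuple permKV permM.
exists x, (perm_tuple y s); split=> //; apply/imsetP; last by exists s.
by exists 1%g => //; apply: eq_from_tnth => i; rewrite tnth_mktuple perm1.
Qed.

Lemma count_mem_tnth x (p : P) : count_mem p x = \sum_(i < n) (tnth x i == p).
Proof. by rewrite -sum1_count big_tuple big_mkcond. Qed.

Lemma sum_count_mem x U :
  \sum_(p in U) count_mem p x = #|[set i | tnth x i \in U]|.
Proof.
rewrite -sum1dep_card (partition_big (tnth x) (mem U)) //=.
apply: eq_bigr => p pU; rewrite count_mem_tnth -big_mkcond /=.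
apply: eq_bigl => i; case: eqP => [->|]; rewrite ?andbF //; by rewrite pU.
Qed.

Definition dominated x y : Prop :=
  forall U, upper_set U ->
    \sum_(p in U) count_mem p x <= \sum_(p in U) count_mem p y.

(** [s] injects the indices where [x] lies in [U] into those where [y] does. *)
Lemma le_perm_tuple_dominated x y (s : 'S_n) :
  (x <= perm_tuple y s)%O -> dominated x y.
Proof.
move=> /le_perm_tupleP le U upU; rewrite !sum_count_mem.
rewrite -(card_imset _ (@perm_inj _ s)); apply: subset_leq_card.
apply/subsetP => _ /imsetP[i + ->]; rewrite !inE => /upU; exact.
Qed.

Lemma dominated_le_perm_tuple x y :
  dominated x y -> exists s : 'S_n, (x <= perm_tuple y s)%O.
Proof.
move=> dom; pose r (i j : 'I_n) := (tnth x i <= tnth y j)%O.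
have [A|f injf rf] := @hall _ _ r; last first.
  by exists (perm injf); apply/le_perm_tupleP => i; rewrite permE; apply: rf.
pose U := [set p | [exists i in A, (tnth x i <= p)%O]].
have upU : upper_set U.
  move=> p q; rewrite !inE => /exists_inP[i iA le_ip] le_pq.
  by apply/exists_inP; exists i => //; apply: le_trans le_pq.
have := dom U upU; rewrite !sum_count_mem => le.
apply: (@leq_trans #|[set i | tnth x i \in U]|).
  apply: subset_leq_card; apply/subsetP => i iA.
  by rewrite !inE; apply/exists_inP; exists i.
(* [tnth y j] lies in the upper closure [U] exactly when [j] is a neighbour of [A]. *)
apply: (leq_trans le); apply: subset_leq_card; apply/subsetP => j.
by rewrite !inE.
Qed.

End SymmetricPower.

(** * Flows on the Hasse diagram *)

Section Flow.

Variables (R : realType) (d : Order.disp_t) (P : finPOrderType d).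
Implicit Types (f g : hasse_edge P -> R) (p q : P).

Local Open Scope ring_scope.

Lemma excess_sum (I : finType) (F : I -> hasse_edge P -> R) p :
  excess (fun e => \sum_i F i e) p = \sum_i excess (F i) p.
Proof. by rewrite /excess !(exchange_big _ _ (index_enum I)) /= -sumrB. Qed.

Lemma excess_add f g p :
  excess (fun e => f e + g e) p = excess f p + excess g p.
Proof. by rewrite /excess !big_split /= opprD addrACA. Qed.

Definition unit_flow p q f : Prop :=
  nonneg_flow f /\ forall z, excess f z = (p == z)%:R - (q == z)%:R.

Lemma unit_flow_edge (e : hasse_edge P) :
  unit_flow (edge_source e) (edge_target e) (fun e' => (e == e')%:R).
Proof.
split=> [e'|z]; first exact: ler0n.
have sumE (Q : pred (hasse_edge P)) : \sum_(e' | Q e') (e == e')%:R = (Q e)%:R :> R.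
  rewrite big_mkcond (bigD1 e) //= eqxx big1 ?addr0; first by case: (Q e).
  by move=> e' /negPf; rewrite eq_sym => ->; case: ifP.
by rewrite /excess !sumE.
Qed.

(** Induction on the number of points strictly between [p] and [q]: a cover is a single edge, and
    otherwise the flows through an intermediate [z] add up, their excesses at [z] cancelling. *)
Lemma unit_flow_le p q : (p <= q)%O -> exists f, unit_flow p q f.
Proof.
have [k] := ubnP #|[set z : P | (p < z < q)%O]|; elim: k => // k IHk in p q *.
rewrite ltnS => lek; rewrite le_eqVlt => /predU1P[->|ltpq].
  exists (fun=> 0); split=> [e|z]; first exact: lexx.
  by rewrite /excess !big1 ?subrr.
have [cov|] := boolP (covers p q).
  by exists (fun e' => (exist _ (p, q) cov == e' :> hasse_edge P)%:R);
    apply: unit_flow_edge.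
rewrite /covers ltpq negbK => /existsP[z /andP[ltpz ltzq]].
have [||f [f0 exf]] := IHk p z; last (have [||g [g0 exg]] := IHk z q).
- apply: leq_trans lek; apply: proper_card; apply/properP; split.
    by apply/subsetP => w; rewrite !inE => /andP[-> /lt_trans ->].
  by exists z; rewrite !inE ?ltpz ?ltzq ?ltxx ?andbF.
- exact: ltW.
- apply: leq_trans lek; apply: proper_card; apply/properP; split.
    by apply/subsetP => w; rewrite !inE => /andP[/(lt_trans ltpz) -> ->].
  by exists z; rewrite !inE ?ltpz ?ltzq ?ltxx ?andbF.
- exact: ltW.
exists (fun e => f e + g e); split=> [e|w]; first exact: addr_ge0 (f0 e) (g0 e).
by rewrite excess_add exf exg addrA subrK.
Qed.

Lemma le_perm_tuple_flow (n : nat) (x y : n.-tupleprod P) (s : 'S_n) :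
  (x <= perm_tuple y s)%O ->
  exists f, nonneg_flow f /\
    forall p, excess f p = (count_mem p x)%:R - (count_mem p y)%:R.
Proof.
move=> /le_perm_tupleP le.
have [F unitF] := fin_all_exists (fun i => unit_flow_le (le i)).
exists (fun e => \sum_i F i e); split=> [e|p].
  by apply: sumr_ge0 => i _; case: (unitF i) => + _; apply.
rewrite excess_sum !count_mem_tnth.
(* Counting the entries of [y] along [s] pairs each [tnth x i] with the endpoint of its flow
   [F i]. *)
rewrite [X in _ - X%:R](reindex_inj (@perm_inj _ s)) /= !natr_sum -sumrB; apply: eq_bigr => i _.
by case: (unitF i) => _ ->.
Qed.

Lemma excess_upper_set_le0 f (U : {set P}) :
  nonneg_flow f -> upper_set U -> \sum_(p in U) excess f p <= 0.
Proof.
move=> f0 upU; rewrite sumrB subr_le0.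
have sumE (h : hasse_edge P -> P) :
    \sum_(p in U) \sum_(e | h e == p) f e = \sum_(e | h e \in U) f e.
  rewrite [RHS](partition_big h (mem U)) //=; apply: eq_bigr => p pU.
  by apply: eq_bigl => e; case: eqP => [->|]; rewrite ?andbF ?pU.
(* Edge by edge: a source in [U] forces the target into [U], and edges entering [U] from outside
   only add to the inflow. *)
rewrite !sumE [leLHS]big_mkcond [leRHS]big_mkcond; apply: ler_sum => e _.
case: ifP => [sU|_]; last by case: ifP => // _; apply: f0.
rewrite (upU _ _ sU) //; case/andP: (valP e) => /ltW; exact.
Qed.

Lemma flow_dominated (n : nat) (x y : n.-tupleprod P) f :
  nonneg_flow f ->
  (forall p, excess f p = (count_mem p x)%:R - (count_mem p y)%:R) ->
  dominated x y.
Proof.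
move=> f0 exf U upU; rewrite -(ler_nat R) !natr_sum -subr_le0 -sumrB.
by under eq_bigr do rewrite -exf; apply: excess_upper_set_le0.
Qed.

End Flow.

Theorem proposition8p4 (R : realType) (d : Order.disp_t)
    (P : finPOrderType d) (n : nat) (x y : n.-tupleprod P) :
  [<-> sym_class_le (sym_class x) (sym_class y);
       exists s : 'S_n, (x <= perm_tuple y s)%O;
       forall U : {set P}, upper_set U ->
         (\sum_(p in U) count_mem p x <= \sum_(p in U) count_mem p y)%N;
       exists f : hasse_edge P -> R,
         nonneg_flow f /\
         forall p : P,
           excess f p = ((count_mem p x)%:R - (count_mem p y)%:R)%R].
Proof.
(* The implications are proved in a cycle; the steps out of (ii) and (iii) both pass through the
   permutation given by Hall's theorem. *)
tfae.
- by move/sym_class_leP.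
- by case=> s /le_perm_tuple_dominated.
- by move/dominated_le_perm_tuple => [s /le_perm_tuple_flow].
- move=> [f [f0 exf]]; apply/sym_class_leP/dominated_le_perm_tuple.
  exact: flow_dominated exf.
Qed.
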